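(* Let $A\in\mathbb{C}^{n\times n}$ with $\mathrm{ind}(A)=k>0$. If $B\in\mathbb{C}^{n\times n}$ is a stable perturbation of $A$ with $\mathrm{ind}(B)=s$, then $$B^{\odot}=W_1^{-1}A^{\odot}\big(I+E_BA^{\odot}\big)^{-1}W_2^{-1},\qquad B^{\pi}=W_2A^{\pi}\big(I+E_BA^{\odot}\big)^{-1}W_2^{-1},$$ where $W_1=(I+YZ)(I-Z)$ is nonsingular with $W_1^{-1}=(I+Z)(I+YZ)^{-1}$, and $W_2=(I-Z^* )(I+Z^*Z)$ is nonsingular with $W_2^{-1}=(I+Z^*Z)^{-1}(I+Z^* )$. Here $L_B=B^2B^{\odot}$, $E_B=L_B-A$, $F_B=L_B-A^*$, $$Y=\big(I+(A^{\odot})^*F_B\big)^{-1}(A^{\odot})^*F_BA^{\pi},\qquad Z=A^{\pi}E_BA^{\odot}\big(I+E_BA^{\odot}\big)^{-1}.$$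
   Context: $(\cdot)^*$ denotes conjugate transpose and $\mathrm{rk}$ denotes rank. The index $\mathrm{ind}(M)$ of a square matrix $M$ is the smallest nonnegative integer $m$ with $\mathrm{rk}(M^{m+1})=\mathrm{rk}(M^m)$ (with $M^0=I$), so $\mathrm{ind}(M)>0$ exactly when $M$ is singular. For $M\in\mathbb{C}^{n\times n}$ with $\mathrm{ind}(M)=m$, $M^{\odot}$ denotes the core-EP inverse of $M$: the unique $X\in\mathbb{C}^{n\times n}$ with $XM^{m+1}=M^m$, $MX^2=X$, $(MX)^*=MX$. Put $M^{\pi}:=I-MM^{\odot}$. $B$ is a stable perturbation of $A$ (with respect to the core-EP inverse) if $I-(B^{\pi}-A^{\pi})^2$ is nonsingular. It is known that in this case $I+E_BA^{\odot}$, $I+(A^{\odot})^*F_B$ and $I+YZ$ are nonsingular, so all the inverses appearing above are well defined. *)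

(* Defs.v *)
From mathcomp Require Import all_boot all_order all_algebra.
Set Implicit Arguments. Unset Strict Implicit. Unset Printing Implicit Defensive.
Import Order.TTheory GRing.Theory Num.Theory.
Local Open Scope ring_scope.
Local Open Scope sesquilinear_scope.

Section CoreEP.
Variables (C : numClosedFieldType) (n : nat).
Implicit Types M X Y A B U : 'M[C]_n.

Let mulE A B : A *m B = A * B. Proof. by []. Qed.

Fact mxindex_exists M : exists m, \rank (M ^+ m.+1) == \rank (M ^+ m).
Proof.
case: (boolP [exists m : 'I_n.+1, \rank (M ^+ m.+1) == \rank (M ^+ m)]).
  by case/existsP=> m; exists m.
move=> /existsPn neq.
have le m : (m <= n.+1)%N -> (\rank (M ^+ m) + m <= n)%N.
  elim: m => [|m IHm] lt_mn; first by rewrite addn0 rank_leq_row.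
  apply: leq_trans (IHm (ltnW lt_mn)); rewrite addnS -addSn leq_add2r.
  rewrite ltn_neqAle (neq (Ordinal lt_mn)) /= exprS.
  exact: mxrankM_maxr.
by have := le n.+1 (leqnn _); rewrite addnS ltnNge leq_addl.
Qed.

Definition mxindex M : nat := ex_minn (mxindex_exists M).

Definition is_core_ep M X : bool :=
  [&& X *m M ^+ (mxindex M).+1 == M ^+ mxindex M,
      M *m X ^+ 2 == X
    & (M *m X)^t* == M *m X].

Lemma adjmxM m p q (U : 'M[C]_(m, p)) (V : 'M[C]_(p, q)) :
  (U *m V)^t* = V^t* *m U^t*.
Proof. by rewrite trmx_mul map_mxM. Qed.

Lemma gram_unit r (F : 'M[C]_(n, r)) : row_full F -> F^t* *m F \in unitmx.
Proof.
move=> Ffull; rewrite -row_free_unit; apply/row_freeP.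
have ker0 (v : 'rV[C]_r) : v *m (F^t* *m F) = 0 -> v = 0.
  move=> vF0; have w0 : v *m F^t* = 0.
    have ww0 : dotmx (v *m F^t*) (v *m F^t*) = 0.
      rewrite dotmxE adjmxM trmxCK !mulmxA -(mulmxA v) vF0.
      by rewrite mul0mx mxE.
    by apply/eqP; rewrite -(dnorm_eq0 (@dotmx C n)); apply/eqP.
  have /row_fullP[L LF] := Ffull.
  by rewrite -[v]mulmx1 -[1%:M]trmxCK trmx1 map_mx1 -LF adjmxM mulmxA w0 mul0mx.
apply/row_freeP; rewrite -kermx_eq0; apply/eqP/row_matrixP=> i.
by rewrite row0; apply: ker0; rewrite -row_mul mulmx_ker row0.
Qed.

Fact core_ep_exists M : exists X, is_core_ep M X.
Proof.
pose m := mxindex M; pose K := M ^+ m.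
have [r [F [G [KE Ffull Gfree]]]] : exists r (F : 'M_(n, r)) (G : 'M_(r, n)),
    [/\ F *m G = K, row_full F & row_free G].
  exists (\rank K), (col_base K), (row_base K).
  by rewrite mulmx_base col_base_full row_base_free.
have GV : G *m pinvmx G = 1%:M by rewrite mulmxVp.
pose T := G *m M *m pinvmx G.
have MK : M *m K = K *m M by rewrite /K !mulE -exprS -exprSr.
have MF : M *m F = F *m T.
  rewrite /T mulmxA (mulmxA F G M) KE -MK -KE (mulmxA M).
  by rewrite -(mulmxA _ G) GV mulmx1.
have Tu : T \in unitmx.
  rewrite -row_free_unit /row_free eqn_leq rank_leq_row /=.
  have rkT : \rank (F *m T *m G) = r.
    rewrite -MF -mulmxA KE -[RHS](eqP Gfree) -(eqmxMfull G Ffull).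
    rewrite KE /K /m /mxindex; case: ex_minnP => j /eqP <- _.
    by rewrite exprS.
  rewrite -[X in (X <= _)%N]rkT.
  exact: leq_trans (mxrankM_maxl _ _) (mxrankM_maxr _ _).
have Hu : F^t* *m F \in unitmx by exact: gram_unit.
set H := F^t* *m F in Hu.
pose X := F *m invmx T *m (invmx H *m F^t*).
have MX : M *m X = F *m (invmx H *m F^t*).
  by rewrite /X !mulmxA MF -(mulmxA F T) mulmxV // mulmx1.
have XF : X *m F = F *m invmx T.
  by rewrite /X -!mulmxA -/H mulVmx // mulmx1.
exists X; apply/and3P; split; apply/eqP.
- rewrite -/m exprS -mulE -/K -KE !mulmxA.
  by rewrite -(mulmxA X) MF mulmxA XF -(mulmxA F) mulVmx // mulmx1.
- rewrite expr2 -mulE mulmxA MX /X -!mulmxA; congr (_ *m _).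
  by rewrite !mulmxA -(mulmxA (invmx H)) -/H mulVmx // mul1mx.
- rewrite MX !adjmxM trmxCK -mulmxA; congr (_ *m (_ *m _)).
  have Hh : H^t* = H by rewrite /H adjmxM trmxCK.
  by rewrite trmx_inv map_invmx Hh.
Qed.

Definition core_ep M : 'M[C]_n := xchoose (core_ep_exists M).

Lemma core_epP M : is_core_ep M (core_ep M).
Proof. exact: xchooseP. Qed.

Lemma core_ep_unique M X : is_core_ep M X -> X = core_ep M.
Proof.
have facts Y : is_core_ep M Y -> let K := M ^+ mxindex M in
    [/\ Y *m M *m K = K, M *m Y *m K = K,
        exists W, Y = K *m W & (M *m Y)^t* = M *m Y].
  case/and3P=> /eqP e1 /eqP e2 /eqP e3 K.
  have YMK : Y *m M *m K = K by rewrite -mulmxA !mulE -exprS.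
  split=> //.
    by rewrite -{1}YMK !mulmxA -[M *m Y *m Y]mulmxA [Y *m Y]mulE -expr2 e2.
  exists (Y ^+ (mxindex M).+1); rewrite /K.
  elim: (mxindex M) => [|j IHj]; first by rewrite expr0 mul1mx expr1.
  have step : M ^+ j.+1 * Y ^+ j.+2 = M ^+ j * (M * Y ^+ 2) * Y ^+ j.
    by rewrite exprSr -[j.+2]/(2 + j)%N exprD !mulrA.
  by rewrite mulE step -[M * _]mulE e2 -mulrA -exprS -mulE.
move=> /facts[XMK MXK [W XE] Xh].
have /facts[YMK MYK [V YE] Yh] := core_epP M.
set Y := core_ep M in YE YMK MYK Yh *.
set K := M ^+ _ in XMK MXK XE YMK MYK YE.
have MK : M *m K = K *m M by rewrite /K !mulE -exprS -exprSr.
have fixK U V' : M *m U *m K = K -> M *m U *m (M *m (K *m V')) = M *m (K *m V').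
  by move=> UK; rewrite (mulmxA M K) MK -(mulmxA K) mulmxA UK.
have XY : M *m X *m (M *m Y) = M *m Y by rewrite YE; apply: fixK.
have YX : M *m Y *m (M *m X) = M *m X by rewrite XE; apply: fixK.
have MXY : M *m X = M *m Y.
  by rewrite -Xh -YX adjmxM Xh Yh XY.
have -> : X = X *m M *m X by rewrite {3}XE mulmxA XMK.
by rewrite -mulmxA MXY {1}YE !mulmxA XMK.
Qed.

Definition core_ep_pi M : 'M[C]_n := 1%:M - M *m core_ep M.

Definition stable_perturbation A B : bool :=
  1%:M - (core_ep_pi B - core_ep_pi A) ^+ 2 \in unitmx.

End CoreEP.

(* Main.v *)
Require Import Defs.
From mathcomp Require Import all_boot all_order all_algebra.
From mathcomp Require Import reals complex.
Import GRing.Theory Num.Theory.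
Local Open Scope ring_scope.
Local Open Scope sesquilinear_scope.

(** Write [P] and [Q] for the orthogonal projectors [A A°] and [B B°], where [°]
    is the core-EP inverse.  The matrix [A°] is invertible in the corner ring
    [P 'M_n P] with inverse [K = A^2 A°], and likewise [T = B°] is inverse to
    [L = B^2 B°] in the corner ring of [Q]; this, with the two projectors being
    Hermitian, is all that the argument retains of core-EP inverses.

    The geometric core is the oblique projector [D] onto the range of [Q] along
    the kernel of [P].  Stability says that [S = I - (P - Q)^2] is invertible.
    Since [S] commutes with [P] and [Q], with [S P = P Q P] and [S Q = Q P Q],
    the matrix [D = S^-1 Q P] is that projector ([oblique_exists]).

    Everything is then explicit in terms of [D].  Put [N = D^* T D], a
    generalised inverse of [L] that lives in the corner of [P].  One has
    [I + E_B A° = I - P + L A°], and its inverse is [I + K N - D], so that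
    [Z = D - P] ([invmx_add_perturbation] and [obliqueB_perturbation]).  The
    same computation for the pair [L^*, T^*], which has the same projector [Q]
    and hence the same [D], gives [Y^* = D - P].  Thus [Y = Z^*], and one matrix
    [H = I + Z^* Z = I - P + D^* D], with inverse [I - P + P Q P], serves for
    both [W_1] and [W_2].  As [Z^2 = 0], [I - Z] and [I + Z] are mutually
    inverse.

    Finally [A° (I + E_B A°)^-1 = N] and [A^pi (I + E_B A°)^-1 = I - D], so the
    two formulas state that [W_1^-1 N W_2^-1 = T] and [W_2 D W_2^-1 = Q].  They
    follow from [(I + Z) H^-1 P = Q P], its adjoint, and [D Q = Q]. *)

(** * Corner inverses and core-EP inverses *)

Section CornerRings.
Set Implicit Arguments.
Unset Strict Implicit.
Variables (C : numClosedFieldType) (n : nat).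
Implicit Types A B D H K L M N P Q S T X Z : 'M[C]_n.

Lemma mulmx1_invmx M N : M *m N = 1%:M -> M \in unitmx /\ invmx M = N.
Proof.
move=> MN; have [Mu _] := mulmx1_unit MN; split=> //.
by rewrite -[LHS]mulmx1 -MN mulKmx.
Qed.

Lemma adjmxB M N : (M - N)^t* = M^t* - N^t*.
Proof. by rewrite linearB map_mxB. Qed.

Lemma adjmxD M N : (M + N)^t* = M^t* + N^t*.
Proof. by rewrite linearD map_mxD. Qed.

Lemma adjmx1 : (1%:M : 'M[C]_n)^t* = 1%:M.
Proof. by rewrite trmx1 map_mx1. Qed.

Lemma adj_unitmx M : (M^t* \in unitmx) = (M \in unitmx).
Proof. by rewrite map_unitmx unitmx_tr. Qed.

Lemma adj_invmx M : (invmx M)^t* = invmx (M^t*).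
Proof. by rewrite trmx_inv map_invmx. Qed.

(** [L] and [T] are inverse units of the corner ring [Q 'M_n Q]; invariance
    under right multiplication by [Q], and [Q *m Q = Q], are consequences. *)
Definition corner_inverse Q L T :=
  [/\ L *m T = Q, T *m L = Q, Q *m L = L & Q *m T = T].

Lemma corner_inverse_mulr Q L T :
  corner_inverse Q L T -> L *m Q = L /\ T *m Q = T.
Proof.
case=> LT TL QL QT; split.
  by rewrite -[in LHS]TL mulmxA LT.
by rewrite -[in LHS]LT mulmxA TL.
Qed.

Lemma corner_inverse_idem Q L T : corner_inverse Q L T -> Q *m Q = Q.
Proof. by case=> LT _ QL _; rewrite -[in X in _ *m X]LT mulmxA QL. Qed.

Lemma corner_inverse_adj Q L T : Q^t* = Q ->
  corner_inverse Q L T -> corner_inverse Q (L^t*) (T^t*).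
Proof.
move=> Qh QLT; have [LQ TQ] := corner_inverse_mulr QLT.
case: QLT => LT TL _ _; split; last 1 [by rewrite -{1}Qh -adjmxM TQ].
- by rewrite -adjmxM TL.
- by rewrite -adjmxM LT.
- by rewrite -{1}Qh -adjmxM LQ.
Qed.

(** The defining equations force [X = core_ep M] to factor as [M^m X^(m+1)]
    with [m] the index.  Hence [X M], which fixes [M^m], also fixes [M X], and
    this makes [M^2 X] a right inverse of [X] relative to [M X]; that it is a
    left one is the equation [M X^2 = X]. *)
Lemma core_ep_corner M : let X := core_ep M in
  (M *m X)^t* = M *m X /\ corner_inverse (M *m X) (M ^+ 2 *m X) X.
Proof.
move=> X; have /and3P[/eqP XMm /eqP MXX /eqP MXh] := core_epP M.
rewrite -/X in XMm MXX MXh.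
set m := mxindex M in XMm.
have MX2 : M *m X *m X = X by rewrite -[RHS]MXX expr2 mulmxA.
have XE : X = M ^+ m *m X ^+ m.+1.
  elim: {XMm} m => [|j IHj]; first by rewrite expr0 mul1mx expr1.
  have step : M *m X *m X = M *m (M ^+ j *m X ^+ j.+1) *m X by rewrite -IHj.
  by rewrite -[LHS]MX2 step (exprS M) (exprSr X j.+1) !mulmxA.
have comm : M *m M ^+ m = M ^+ m *m M by rewrite -[LHS]exprS exprSr.
have XMMm : X *m M *m M ^+ m = M ^+ m.
  by rewrite -mulmxA -[M *m M ^+ m]exprS.
have XMMX : X *m M *m (M *m X) = M *m X.
  rewrite {2}XE (mulmxA M) comm -(mulmxA (M ^+ m)) mulmxA XMMm mulmxA -comm.
  by rewrite -mulmxA -XE.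
have M2 : M ^+ 2 = M *m M by rewrite expr2.
split=> //; split=> //.
- by rewrite M2 -!mulmxA (mulmxA M X X) MX2.
- by rewrite M2 -[M *m M *m X]mulmxA mulmxA XMMX.
- rewrite M2 -[M *m M *m X]mulmxA -(mulmxA M X) (mulmxA X M).
  by rewrite XMMX.
Qed.

(** * The oblique projector *)

(** These identities characterise [D] as the idempotent with the range of [Q]
    and the kernel of [P]. *)
Definition oblique P Q D :=
  [/\ P *m D = P, D *m P = D, Q *m D = D & D *m Q = Q].

(** [1 - (P - Q)^2] commutes with both projectors and acts as [P Q P] on the
    first and as [Q P Q] on the second, so its inverse turns [Q P] into the
    required projector. *)
Lemma oblique_exists P Q : P *m P = P -> Q *m Q = Q ->
  1%:M - (P - Q) *m (P - Q) \in unitmx -> exists D, oblique P Q D.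
Proof.
move=> PP QQ; set S := 1%:M - _ => Su.
have SE : S = 1%:M - P + P *m Q + Q *m P - Q.
  rewrite /S mulmxBl !mulmxBr PP QQ !opprB !addrA.
  by rewrite [LHS](ACl (1*5*4*2*3)).
have SP : S *m P = P *m Q *m P.
  by rewrite SE !(mulmxBl, mulmxDl) mul1mx PP subrr add0r -(mulmxA Q P) PP addrK.
have PS : P *m S = P *m Q *m P.
  rewrite SE mulmxBr !mulmxDr mulmxN mulmx1 !mulmxA PP.
  by rewrite subrr add0r addrC addKr.
have SQ : S *m Q = Q *m P *m Q.
  rewrite SE mulmxBl !mulmxDl mulNmx mul1mx -(mulmxA P Q) QQ subrK.
  by rewrite addrC addKr.
have QS : Q *m S = Q *m P *m Q.
  rewrite SE mulmxBr !mulmxDr mulmxN mulmx1 !mulmxA QQ.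
  by rewrite [LHS](ACl ((1*5)*3*(4*2))) /= !subrr add0r addr0.
have comm U : S *m U = U *m S -> U *m invmx S = invmx S *m U.
  by move=> SU; rewrite -[LHS](mulKmx Su) (mulmxA S) SU mulmxK.
have PV := comm P (etrans SP (esym PS)); have QV := comm Q (etrans SQ (esym QS)).
exists (invmx S *m (Q *m P)); split.
- by rewrite mulmxA PV -mulmxA (mulmxA P) -SP mulKmx.
- by rewrite -!mulmxA PP.
- by rewrite mulmxA QV -mulmxA (mulmxA Q Q) QQ.
- by rewrite -mulmxA -SQ mulKmx.
Qed.

Section Oblique.
Variables P Q D : 'M[C]_n.
Hypotheses (Ph : P^t* = P) (Qh : Q^t* = Q) (PQD : oblique P Q D).

Let PD : P *m D = P. Proof. by case: PQD. Qed.
Let DP : D *m P = D. Proof. by case: PQD. Qed.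
Let QD : Q *m D = D. Proof. by case: PQD. Qed.
Let DQ : D *m Q = Q. Proof. by case: PQD. Qed.
Let DaP : D^t* *m P = P. Proof. by rewrite -{1}Ph -adjmxM PD. Qed.
Let PDa : P *m D^t* = D^t*. Proof. by rewrite -{1}Ph -adjmxM DP. Qed.
Let DaQ : D^t* *m Q = D^t*. Proof. by rewrite -{1}Qh -adjmxM QD. Qed.
Let QDa : Q *m D^t* = Q. Proof. by rewrite -{1}Qh -adjmxM DQ. Qed.
Let PP : P *m P = P. Proof. by rewrite -{1}PD -mulmxA DP PD. Qed.
Let DD : D *m D = D. Proof. by rewrite -{1}DP -mulmxA PD. Qed.

(** * The perturbed matrix and its inverse *)

Section Perturbation.
Variables K X L T : 'M[C]_n.
Hypotheses (PKX : corner_inverse P K X) (QLT : corner_inverse Q L T).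

Let N := D^t* *m T *m D.

Let PN : P *m N = N. Proof. by rewrite /N !mulmxA PDa. Qed.

Let LN : L *m N = D.
Proof.
have [LQ _] := corner_inverse_mulr QLT; case: QLT => LT _ _ _.
by rewrite /N -{1}LQ !mulmxA -(mulmxA L) QDa LQ LT QD.
Qed.

Let compl_mul : (1%:M - P) *m (1%:M + K *m N - D) = 1%:M - D.
Proof.
case: PKX => _ _ PK _.
rewrite mulmxBl mul1mx mulmxBr mulmxDr mulmx1 (mulmxA P) PK PD.
by rewrite [P + _]addrC addrK addrAC addrK.
Qed.

(** In blocks adapted to [P], the matrix [1 - P + L X] is lower triangular with
    diagonal blocks [l x] and [1], where [l] and [x] are the corner blocks of
    [L] and [X]; [N] is [l^-1], and [D - P] is the block below the diagonal of
    [L] multiplied by [l^-1]. *)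
Lemma invmx_add_perturbation : 1%:M - P + L *m X \in unitmx /\
  invmx (1%:M - P + L *m X) = 1%:M + K *m N - D.
Proof.
have [_ XP] := corner_inverse_mulr PKX; case: PKX => _ XK _ _.
apply: mulmx1_invmx; rewrite mulmxDl compl_mul.
rewrite mulmxBr mulmxDr mulmx1.
have -> : L *m X *m D = L *m X by rewrite -{1}XP !mulmxA -(mulmxA _ P) PD -mulmxA XP.
have -> : L *m X *m (K *m N) = D by rewrite -!mulmxA (mulmxA X) XK PN LN.
by rewrite [L *m X + D]addrC addrK subrK.
Qed.

Lemma obliqueB_perturbation :
  (1%:M - P) *m (L *m X - P) *m invmx (1%:M - P + L *m X) = D - P.
Proof.
have [Mu iM] := invmx_add_perturbation.
have -> : L *m X - P = (1%:M - P + L *m X) - 1%:M.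
  by rewrite [RHS](ACl (1*4*(3*2))) /= subrr add0r.
rewrite -mulmxA (mulmxBl _ 1%:M) mulmxV // mul1mx iM mulmxBr compl_mul mulmx1.
by rewrite opprB addrA [LHS](ACl (1*4*3*2)) /= subrr add0r.
Qed.

Lemma core_mul_invmx : X *m invmx (1%:M - P + L *m X) = N.
Proof.
have [_ ->] := invmx_add_perturbation.
have [_ XP] := corner_inverse_mulr PKX; case: PKX => _ XK _ _.
rewrite mulmxBr mulmxDr mulmx1 (mulmxA X) XK PN.
by rewrite -[X in _ - X *m D]XP -mulmxA PD XP addrC addKr.
Qed.

Lemma compl_mul_invmx :
  (1%:M - P) *m invmx (1%:M - P + L *m X) = 1%:M - D.
Proof. by have [_ ->] := invmx_add_perturbation. Qed.

End Perturbation.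

(** * The similarity matrices *)

Let Z := D - P.
Let H := 1%:M + Z^t* *m Z.

Let ZE : Z^t* = D^t* - P. Proof. by rewrite adjmxB Ph. Qed.

Let ZZ : Z *m Z = 0.
Proof. by rewrite /Z mulmxBl !mulmxBr DD DP PD PP !subrr. Qed.

Let ZaZa : Z^t* *m Z^t* = 0. Proof. by rewrite -adjmxM ZZ trmx0 map_mx0. Qed.

Let HE : H = 1%:M - P + D^t* *m D.
Proof.
rewrite /H ZE mulmxBl !mulmxBr DaP PD PP subrr subr0.
by rewrite -addrA [- P + _]addrC.
Qed.

Lemma obliqueB_gram_unit : H \in unitmx /\ invmx H = 1%:M - P + P *m Q *m P.
Proof.
have CP : (1%:M - P) *m P = 0 by rewrite mulmxBl mul1mx PP subrr.
have CH : (1%:M - P) *m (1%:M - P + P *m Q *m P) = 1%:M - P.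
  by rewrite mulmxDr mulmxBr mulmx1 !mulmxA CP !mul0mx addr0 subr0.
have DH : D *m (1%:M - P + P *m Q *m P) = Q *m P.
  by rewrite mulmxDr mulmxBr mulmx1 !mulmxA DP subrr add0r DQ.
apply: mulmx1_invmx.
by rewrite HE mulmxDl CH -mulmxA DH mulmxA DaQ DaP subrK.
Qed.

Let Hu : H \in unitmx. Proof. by case: obliqueB_gram_unit. Qed.

Lemma W1_inverse : H *m (1%:M - Z) \in unitmx /\
  invmx (H *m (1%:M - Z)) = (1%:M + Z) *m invmx H.
Proof.
have ZV : (1%:M - Z) *m (1%:M + Z) = 1%:M.
  by rewrite mulmxBl mul1mx mulmxDr mulmx1 ZZ addr0 addrK.
by apply: mulmx1_invmx; rewrite mulmxA -(mulmxA H) ZV mulmx1 mulmxV.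
Qed.

Lemma W2_inverse : (1%:M - Z^t*) *m H \in unitmx /\
  invmx ((1%:M - Z^t*) *m H) = invmx H *m (1%:M + Z^t*).
Proof.
apply: mulmx1_invmx; rewrite mulmxA -(mulmxA _ H) mulmxV // mulmx1.
by rewrite mulmxBl mul1mx mulmxDr mulmx1 ZaZa addr0 addrK.
Qed.

(** [1 + Z] carries the range of [P] onto that of [Q], and [H^-1] compensates
    for its failure to be isometric there. *)
Lemma W1_inverse_mulP : (1%:M + Z) *m invmx H *m P = Q *m P.
Proof.
have [_ ->] := obliqueB_gram_unit.
have HP : (1%:M - P + P *m Q *m P) *m P = P *m (Q *m P).
  by rewrite mulmxDl mulmxBl mul1mx PP subrr add0r -!mulmxA PP.
have ZP : (1%:M + Z) *m P = D.
  by rewrite mulmxDl mul1mx /Z mulmxBl DP PP addrC subrK.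
by rewrite -mulmxA HP mulmxA ZP mulmxA DQ.
Qed.

Lemma mulP_W2_inverse : P *m (invmx H *m (1%:M + Z^t*)) = P *m Q.
Proof.
have Hh : H^t* = H by rewrite adjmxD adjmx1 adjmxM trmxCK.
have := congr1 (fun U => U^t*) W1_inverse_mulP.
by rewrite /= !adjmxM adj_invmx Hh adjmxD adjmx1 Ph Qh.
Qed.

(** With [N = D^* T D] the left side collapses to [Q N Q], and [Q] absorbs
    [D^*] on its right and [D] on its left. *)
Lemma corner_conj L T : corner_inverse Q L T ->
  (1%:M + Z) *m invmx H *m (D^t* *m T *m D) *m (invmx H *m (1%:M + Z^t*)) = T.
Proof.
move=> QLT; have [_ TQ] := corner_inverse_mulr QLT; case: QLT => _ _ _ QT.
have -> : D^t* *m T *m D = P *m (D^t* *m T *m D) *m P.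
  by rewrite !mulmxA PDa -(mulmxA _ D P) DP.
have assoc (U V W : 'M[C]_n) : U *m (P *m V *m P) *m W = U *m P *m V *m (P *m W).
  by rewrite !mulmxA.
rewrite assoc W1_inverse_mulP mulP_W2_inverse !mulmxA.
by rewrite -(mulmxA Q P) PDa QDa QT -(mulmxA T D) DP -mulmxA DQ TQ.
Qed.

(** Right multiplication by [W_2^-1] turns [D] into [Q], which [W_2] fixes. *)
Lemma oblique_conj :
  (1%:M - Z^t*) *m H *m (1%:M - D) *m (invmx H *m (1%:M + Z^t*)) = 1%:M - Q.
Proof.
have [W2u iW2] := W2_inverse.
rewrite mulmxBr mulmx1 mulmxBl -iW2 mulmxV //; congr (_ - _).
have -> : (1%:M - Z^t*) *m H *m D *m invmx ((1%:M - Z^t*) *m H)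
    = (1%:M - Z^t*) *m (H *m Q).
  rewrite iW2 -!mulmxA; congr (_ *m (_ *m _)).
  by rewrite -[in LHS]DP -mulmxA mulP_W2_inverse mulmxA DP DQ.
have -> : H *m Q = Q - P *m Q + D^t*.
  by rewrite HE mulmxDl mulmxBl mul1mx -mulmxA DQ DaQ.
have DaDa : D^t* *m D^t* = D^t* by rewrite -adjmxM DD.
have DW : D^t* *m (Q - P *m Q + D^t*) = D^t* - P *m Q + D^t*.
  by rewrite mulmxDr mulmxBr mulmxA DaQ DaP DaDa.
have PW : P *m (Q - P *m Q + D^t*) = D^t*.
  by rewrite mulmxDr mulmxBr mulmxA PP subrr add0r PDa.
rewrite mulmxBl mul1mx ZE (mulmxBl (D^t*)) DW PW addrK opprB.
by rewrite addrA addrAC addrK subrK.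
Qed.

End Oblique.
End CornerRings.

(** * Assembling the formulas *)

Lemma core_ep_perturbation (C : numClosedFieldType) (n : nat)
    (A B : 'M[C]_n) (stableAB : stable_perturbation A B) :
  let I : 'M[C]_n := 1%:M in
  let Aep := core_ep A in
  let Api := core_ep_pi A in
  let L := B ^+ 2 *m core_ep B in
  let E := L - A in
  let F := L - A^t* in
  let Y := invmx (I + Aep^t* *m F) *m Aep^t* *m F *m Api in
  let Z := Api *m E *m Aep *m invmx (I + E *m Aep) in
  let W1 := (I + Y *m Z) *m (I - Z) in
  let W2 := (I - Z^t*) *m (I + Z^t* *m Z) in
  [/\ I + E *m Aep \in unitmx, I + Aep^t* *m F \in unitmx,
      I + Y *m Z \in unitmx & I + Z^t* *m Z \in unitmx] /\
  [/\ W1 \in unitmx,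
      invmx W1 = (I + Z) *m invmx (I + Y *m Z),
      W2 \in unitmx &
      invmx W2 = invmx (I + Z^t* *m Z) *m (I + Z^t*)] /\
  core_ep B = invmx W1 *m Aep *m invmx (I + E *m Aep) *m invmx W2 /\
  core_ep_pi B = W2 *m Api *m invmx (I + E *m Aep) *m invmx W2.
Proof.
move=> I Aep Api L E F Y Z W1 W2.
have [Ph PKX] := core_ep_corner A; have [Qh QLT] := core_ep_corner B.
set P := A *m core_ep A in Ph PKX; set Q := B *m core_ep B in Qh QLT.
have [D PQD] : exists D, oblique P Q D.
  apply: oblique_exists.
  - exact: corner_inverse_idem PKX.
  - exact: corner_inverse_idem QLT.
  suff -> : P - Q = core_ep_pi B - core_ep_pi A by exact: stableAB.
  by rewrite /core_ep_pi -/P -/Q opprB [RHS]addrC [RHS]addrA subrK.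
have QLTa := corner_inverse_adj Qh QLT.
have EX : E *m Aep = L *m Aep - P by rewrite mulmxBl.
have FX : (Aep^t* *m F)^t* = L^t* *m Aep - P.
  by rewrite adjmxM trmxCK adjmxB trmxCK mulmxBl.
have ME : I + E *m Aep = 1%:M - P + L *m Aep by rewrite EX addrCA addrC.
have MF : (I + Aep^t* *m F)^t* = 1%:M - P + L^t* *m Aep.
  by rewrite adjmxD adjmx1 FX addrCA addrC.
have [MEu _] := invmx_add_perturbation Ph Qh PQD PKX QLT.
have [MFu _] := invmx_add_perturbation Ph Qh PQD PKX QLTa.
have ZE : Z = D - P.
  rewrite /Z ME -(mulmxA Api) EX.
  exact: (obliqueB_perturbation Ph Qh PQD PKX QLT).
have YE : Y = Z^t*.
  (* [Y^*] is [Z] for the data [L^*], [T^*], and [D] depends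
     on the projectors alone. *)
  have Apih : Api^t* = Api by rewrite adjmxB adjmx1 Ph.
  rewrite -[Y]trmxCK ZE; congr (_^t*).
  rewrite /Y -(mulmxA _ _ F) 2!adjmxM adj_invmx MF FX Apih mulmxA.
  exact: (obliqueB_perturbation Ph Qh PQD PKX QLTa).
have [Hu _] := obliqueB_gram_unit Ph Qh PQD.
have [W1u W1V] := W1_inverse Ph Qh PQD.
have [W2u W2V] := W2_inverse Ph Qh PQD.
rewrite -ZE in Hu W1u W1V W2u W2V.
rewrite /W1 /W2 YE; split; [split=> // | split; [by [] | split]].
- by rewrite ME.
- by rewrite -adj_unitmx MF.
- rewrite ME W1V W2V -(mulmxA _ Aep) (core_mul_invmx Ph Qh PQD PKX QLT).
  by rewrite ZE (corner_conj Ph Qh PQD QLT).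
- rewrite ME W2V -(mulmxA _ Api) (compl_mul_invmx Ph Qh PQD PKX QLT).
  by rewrite ZE; apply/esym/(oblique_conj Ph Qh PQD).
Qed.

Theorem theorem3p5 (R : realType) (n k s : nat) (A B : 'M[R[i]]_n)
    (indA : mxindex A = k) (k_gt0 : (0 < k)%N) (indB : mxindex B = s)
    (stableAB : stable_perturbation A B) :
  let I : 'M[R[i]]_n := 1%:M in
  let Aep := core_ep A in
  let Api := core_ep_pi A in
  let L := B ^+ 2 *m core_ep B in
  let E := L - A in
  let F := L - A^t* in
  let Y := invmx (I + Aep^t* *m F) *m Aep^t* *m F *m Api in
  let Z := Api *m E *m Aep *m invmx (I + E *m Aep) in
  let W1 := (I + Y *m Z) *m (I - Z) in
  let W2 := (I - Z^t*) *m (I + Z^t* *m Z) in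
  [/\ I + E *m Aep \in unitmx, I + Aep^t* *m F \in unitmx,
      I + Y *m Z \in unitmx & I + Z^t* *m Z \in unitmx] /\
  [/\ W1 \in unitmx,
      invmx W1 = (I + Z) *m invmx (I + Y *m Z),
      W2 \in unitmx &
      invmx W2 = invmx (I + Z^t* *m Z) *m (I + Z^t*)] /\
  core_ep B = invmx W1 *m Aep *m invmx (I + E *m Aep) *m invmx W2 /\
  core_ep_pi B = W2 *m Api *m invmx (I + E *m Aep) *m invmx W2.
Proof. exact: core_ep_perturbation stableAB. Qed.
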